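(* Let $n\ge2$, $b>0$, and let $Q:\mathbb{R}^{n-1}\times[0,b]\times\mathbb{R}\to\mathbb{C}$, $V=(V',V_n):\mathbb{R}^{n-1}\times[0,b]\times\mathbb{R}\to\mathbb{C}^n$, and $m:\mathbb{R}^{n-1}\times\mathbb{R}\to\mathbb{C}$ be as defined in the context. Then, for each fixed $\gamma\in\mathbb{R}$, for $|\xi|\ll1$ we have the asymptotic developments $$V'(\xi,x_n,\gamma)=-i\pi\xi(2x_nb-x_n^2)+O(|\xi|^2),\qquad V_n(\xi,x_n,\gamma)=2\pi^2|\xi|^2x_n^2\Big(\frac{x_n}{3}-b\Big)+O(|\xi|^3),$$ $$m(\xi,\gamma)=-\frac{4\pi^2|\xi|^2b^3}{3}+O(|\xi|^3),\qquad Q(\xi,x_n,\gamma)=1+O(|\xi|^2),$$ where $F(\xi,x_n)=O(|\xi|^k)$ means that $\limsup_{|\xi|\to0}\sup_{0\le x_n\le b}\frac{|F(\xi,x_n)|}{|\xi|^k}<\infty$.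
   Context: For $\xi\in\mathbb{R}^{n-1}$, $\gamma\in\mathbb{R}$ let $$A(\xi,\gamma)=\begin{pmatrix}0&0&0&1\\-2\pi|\xi|&0&0&0\\0&-(4\pi^2|\xi|^2-2\pi i\xi_1\gamma)&0&-2\pi|\xi|\\4\pi^2|\xi|^2-2\pi i\xi_1\gamma&0&-2\pi|\xi|&0\end{pmatrix},$$ $$M=\begin{pmatrix}1&0&0&0\\0&1&0&0\\0&0&0&0\\0&0&0&0\end{pmatrix},\quad N=\begin{pmatrix}0&0&0&0\\0&0&0&0\\0&2\pi|\xi|&0&-1\\4\pi|\xi|&0&1&0\end{pmatrix},\quad B(\xi,\gamma)=M+N\exp(bA(\xi,\gamma)),$$ where $B(\xi,\gamma)$ is invertible for all $\xi,\gamma$. With $y(\xi,x_n,\gamma)=\exp(x_nA(\xi,\gamma))B(\xi,\gamma)^{-1}e_4\in\mathbb{C}^4$, set $Q(\xi,x_n,\gamma)=y_3(\xi,x_n,\gamma)$; $V_n(\xi,x_n,\gamma)=y_2(\xi,x_n,\gamma)$; $V'(\xi,x_n,\gamma)=-i\,y_1(\xi,x_n,\gamma)\,\xi/|\xi|\in\mathbb{C}^{n-1}$ for $\xi\ne0$ and $V'(0,x_n,\gamma)=0$; $m(\xi,\gamma)=V_n(\xi,b,\gamma)$. *)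

(* Defs.v *)
From mathcomp Require Import all_boot all_order all_algebra.
From mathcomp Require Export complex.
From mathcomp Require Import all_classical all_reals all_analysis.

Set Implicit Arguments.
Unset Strict Implicit.
Unset Printing Implicit Defensive.

Import Order.TTheory GRing.Theory Num.Theory.
Import numFieldNormedType.Exports.

Local Open Scope classical_set_scope.
Local Open Scope ring_scope.
Local Open Scope complex_scope.

(* Euclidean norm; MathComp-Analysis' own norm on row vectors is the sup norm. *)
Definition enorm (R : realType) (d : nat) (v : 'rV[R]_d) : R :=
  Num.sqrt (\sum_(j < d) v 0 j ^+ 2).

(* `|z| lives in R[i]; its real part is the modulus as an element of R. *)
Definition cabs (R : realType) (z : R[i]) : R := complex.Re `|z|.

(* Hermitian norm on C^d. *)
Definition cenorm (R : realType) (d : nat) (v : 'rV[R[i]]_d) : R :=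
  Num.sqrt (\sum_(j < d) cabs (v 0 j) ^+ 2).

(* The limit is taken in the normed space of complex square matrices. *)
Definition mexp (R : realType) (k : nat) (A : 'M[R[i]]_k.+1) : 'M[R[i]]_k.+1 :=
  lim (series (fun j : nat => (j`!%:R)^-1 *: A ^+ j) @ \oo).

Definition mx4 (R : realType) (rows : seq (seq R[i])) : 'M[R[i]]_4 :=
  \matrix_(i < 4, j < 4) nth 0 (nth [::] rows i) j.

(* The spatial dimension is n = d + 2, so that xi ranges over R^(n-1) with
   n - 1 = d.+1 >= 1 and the coordinate xi_1 is xi 0 ord0. *)

Definition coefA (R : realType) (d : nat) (xi : 'rV[R]_d.+1) (gamma : R) :
    R[i] :=
  (4 * pi ^+ 2 * enorm xi ^+ 2)%:C - (2 * pi)%:C * 'i%C * (xi 0 ord0 * gamma)%:C.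

Definition matA (R : realType) (d : nat) (xi : 'rV[R]_d.+1) (gamma : R) :
    'M[R[i]]_4 :=
  let r := (2 * pi * enorm xi)%:C in
  let c := coefA xi gamma in
  mx4 [:: [::   0;   0;   0;   1];
          [:: - r;   0;   0;   0];
          [::   0; - c;   0; - r];
          [::   c;   0; - r;   0]].

Definition matM (R : realType) : 'M[R[i]]_4 :=
  mx4 [:: [:: 1; 0; 0; 0];
          [:: 0; 1; 0; 0];
          [:: 0; 0; 0; 0];
          [:: 0; 0; 0; 0]].

Definition matN (R : realType) (d : nat) (xi : 'rV[R]_d.+1) : 'M[R[i]]_4 :=
  let r := (2 * pi * enorm xi)%:C in
  let s := (4 * pi * enorm xi)%:C in
  mx4 [:: [:: 0; 0; 0;   0];
          [:: 0; 0; 0;   0];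
          [:: 0; r; 0; - 1];
          [:: s; 0; 1;   0]].

Definition matB (R : realType) (d : nat) (b : R) (xi : 'rV[R]_d.+1)
    (gamma : R) : 'M[R[i]]_4 :=
  matM R + matN xi *m mexp (b%:C *: matA xi gamma).

Definition soly (R : realType) (d : nat) (b : R) (xi : 'rV[R]_d.+1)
    (xn gamma : R) : 'cV[R[i]]_4 :=
  mexp (xn%:C *: matA xi gamma) *m invmx (matB b xi gamma)
    *m delta_mx (inord 3) 0.

(* Ordinals start at 0: y_1, y_2, y_3 are the entries of index 0, 1, 2. *)
Definition Qpressure (R : realType) (d : nat) (b : R) (xi : 'rV[R]_d.+1)
    (xn gamma : R) : R[i] :=
  soly b xi xn gamma (inord 2) 0.

Definition Vnormal (R : realType) (d : nat) (b : R) (xi : 'rV[R]_d.+1)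
    (xn gamma : R) : R[i] :=
  soly b xi xn gamma (inord 1) 0.

(* V', the first n - 1 components of V *)
Definition Vtangent (R : realType) (d : nat) (b : R) (xi : 'rV[R]_d.+1)
    (xn gamma : R) : 'rV[R[i]]_d.+1 :=
  if xi == 0 then 0
  else \row_(j < d.+1)
    (- 'i%C * soly b xi xn gamma (inord 0) 0 * (xi 0 j / enorm xi)%:C).

Definition msymb (R : realType) (d : nat) (b : R) (xi : 'rV[R]_d.+1)
    (gamma : R) : R[i] :=
  Vnormal b xi b gamma.

(* F(xi, x_n) = O(|xi|^k), i.e.
   limsup_(|xi| -> 0) sup_(0 <= x_n <= b) |F(xi, x_n)| / |xi|^k < +oo,
   where nrm is the norm of the codomain of F. *)
Definition bigO_at0 (R : realType) (d : nat) (T : Type) (nrm : T -> R) (b : R)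
    (k : nat) (F : 'rV[R]_d.+1 -> R -> T) : Prop :=
  let sup_ratio (xi : 'rV[R]_d.+1) : \bar R :=
    ereal_sup [set (nrm (F xi xn) / enorm xi ^+ k)%:E
              | xn in [set xn : R | 0 <= xn <= b]] in
  (limf_esup sup_ratio (0 : 'rV[R]_d.+1)^' < +oo%E)%O.

(* Main.v *)
(** Put rho = |xi| and y = S z with S = diag(rho, rho^2, 1, rho). Then A S = S A'
    and B S = T B' with T = diag(rho, rho^2, rho, 1), where the rescaled matrices
    A' and B' depend on rho and on c = 4 pi^2 rho^2 - 2 pi i xi_1 gamma = O(rho)
    only, and T e_4 = e_4, so that z(x) = exp(x A') B'^-1 e_4. As rho -> 0, A' tends
    to a nilpotent matrix at rate O(rho), and so, by Lipschitz continuity of the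
    exponential and of the inverse, z is within O(rho) of its limit, an explicit
    polynomial in x: undoing the scaling gives the expansions of V' and V_n. For
    Q = z_3 the rate improves to O(rho^2): the third row of A' is O(rho^2), so
    z_3 varies by O(rho^2) over [0, b], and the boundary condition
    4 pi rho^2 z_1 + z_3 = 1 at x = b fixes its value there up to O(rho^2). *)

Require Import Defs.
From mathcomp Require Import all_boot all_order all_algebra.
From mathcomp Require Import complex.
From mathcomp Require Import all_classical all_reals all_analysis.
From mathcomp Require Import ring lra.

Set Implicit Arguments.
Unset Strict Implicit.
Unset Printing Implicit Defensive.

Import Order.TTheory GRing.Theory Num.Theory.
Import numFieldNormedType.Exports.

Local Open Scope classical_set_scope.
Local Open Scope ring_scope.
Local Open Scope complex_scope.

(** * Real-valued modulus on the complex numbers and dominated complex series *)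

Section ComplexModulus.
Context {R : realType}.
Implicit Types z w : R[i].

Lemma normc_cabs z : `|z| = (cabs z)%:C.
Proof. by rewrite /cabs normc_def. Qed.

Lemma cabs_ge0 z : 0 <= cabs z.
Proof. by rewrite /cabs normc_def /= sqrtr_ge0. Qed.

Lemma cabsM z w : cabs (z * w) = cabs z * cabs w.
Proof. by apply: complexI; rewrite rmorphM /= -!normc_cabs normrM. Qed.

Lemma cabsD z w : cabs (z + w) <= cabs z + cabs w.
Proof. by rewrite -lecR rmorphD /= -!normc_cabs ler_normD. Qed.

Lemma cabsN z : cabs (- z) = cabs z.
Proof. by rewrite /cabs normrN. Qed.

Lemma cabs_real (x : R) : cabs x%:C = `|x|.
Proof. by rewrite /cabs normc_def /= expr0n /= addr0 sqrtr_sqr. Qed.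

Lemma cabs0 : cabs (0 : R[i]) = 0.
Proof. by rewrite /cabs normr0. Qed.

Lemma cabs_i : cabs ('i : R[i]) = 1.
Proof. by rewrite /cabs normc_def /= expr0n expr1n add0r sqrtr1. Qed.

Lemma cabs_eq0 z : cabs z = 0 -> z = 0.
Proof. by move=> z0; apply/eqP; rewrite -normr_eq0 normc_cabs z0. Qed.

Lemma cabs_le_ReIm z : cabs z <= `|complex.Re z| + `|complex.Im z|.
Proof.
rewrite {1}[z]complexE; apply: le_trans (cabsD _ _) _.
by rewrite cabsM cabs_i mul1r !cabs_real.
Qed.

Lemma Re_le_cabs z : `|complex.Re z| <= cabs z.
Proof. by rewrite -lecR -normc_cabs; exact: normc_ge_Re. Qed.

Lemma Im_le_cabs z : `|complex.Im z| <= cabs z.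
Proof.
have := Re_le_cabs (z * 'i%C).
by rewrite ReiNIm normrN cabsM cabs_i mulr1.
Qed.

(** Serves for the third component of the rescaled solution: [z] and [t] are its values at x and at
    b, [w] its initial value, and [a] is 1. *)
Lemma cabsB_chain z w t a (k l : R) :
  cabs (z - w) <= k -> cabs (t - w) <= k -> cabs (t - a) <= l ->
  cabs (z - a) <= 2 * k + l.
Proof.
have -> : z - a = (z - w) + (- (t - w) + (t - a)) by ring.
have := cabsD (z - w) (- (t - w) + (t - a)).
have := cabsD (- (t - w)) (t - a); rewrite cabsN.
lra.
Qed.

Lemma cabs_sum (I : Type) (r : seq I) (P : pred I) (F : I -> R[i]) :
  cabs (\sum_(i <- r | P i) F i) <= \sum_(i <- r | P i) cabs (F i).
Proof.
elim/big_ind2: _ => [|x1 x2 y1 y2 h1 h2|//]; first by rewrite cabs0.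
by apply: le_trans (cabsD _ _) _; exact: lerD.
Qed.

Lemma series_ReE (u : nat -> R[i]) n :
  complex.Re (series u n) = series (fun j => complex.Re (u j)) n.
Proof.
rewrite /series /=; elim: n => [|n IH]; first by rewrite !big_geq.
rewrite !big_nat_recr //= -IH.
by case: (\sum_(0 <= i < n) u i) => ? ?; case: (u n).
Qed.

Lemma series_ImE (u : nat -> R[i]) n :
  complex.Im (series u n) = series (fun j => complex.Im (u j)) n.
Proof.
rewrite /series /=; elim: n => [|n IH]; first by rewrite !big_geq.
rewrite !big_nat_recr //= -IH.
by case: (\sum_(0 <= i < n) u i) => ? ?; case: (u n).
Qed.

(** Real and imaginary parts are both dominated by [v], hence converge absolutely. Convergence is
    expressed through [cabs], so that all limits are taken in R. *)
Lemma complex_series_cvg (u : nat -> R[i]) (v : nat -> R) :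
  (forall n, cabs (u n) <= v n) -> cvgn (series v) ->
  exists l, cabs (l - series u n) @[n --> \oo] --> 0.
Proof.
move=> uv cv.
have cvF (F : R[i] -> R) : (forall z, `|F z| <= cabs z) ->
    cvgn (series (fun j => F (u j))).
  move=> hF; apply: (@normed_cvg R R^o); apply: series_le_cvg cv => n //=.
  - exact: le_trans (cabs_ge0 _) (uv n).
  - exact: le_trans (hF _) (uv n).
have /cvg_ex[lr hr] := cvF _ Re_le_cabs.
have /cvg_ex[li hi] := cvF _ Im_le_cabs.
exists (lr +i* li)%C.
apply: (@squeeze_cvgr _ _ _ _ (fun=> 0) (fun n =>
   `|lr - series (fun j => complex.Re (u j)) n| +
   `|li - series (fun j => complex.Im (u j)) n|)).
- near=> n; rewrite cabs_ge0 /=; apply: le_trans (cabs_le_ReIm _) _.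
  rewrite -series_ReE -series_ImE.
  by case: (series u n).
- exact: cvg_cst.
- rewrite -[X in _ --> X](addr0 0); apply: cvgD.
  + rewrite -[X in _ --> X](normr0 R) -[X in `|X|](subrr lr).
    by apply: cvg_norm; apply: cvgB => //; exact: cvg_cst.
  + rewrite -[X in _ --> X](normr0 R) -[X in `|X|](subrr li).
    by apply: cvg_norm; apply: cvgB => //; exact: cvg_cst.
Unshelve. all: by end_near. Qed.

End ComplexModulus.

(** * The entrywise l^1 norm of complex matrices *)

Section SumNorm.
Context {R : realType}.

(** Unlike the maximum norm, this one is submultiplicative with constant 1, for rectangular products
    too; it takes its values in R rather than in R[i]. *)
Definition sumnorm (m n : nat) (A : 'M[R[i]]_(m, n)) : R :=
  \sum_i \sum_j cabs (A i j).

Lemma sumnorm_ge0 m n (A : 'M[R[i]]_(m, n)) : 0 <= sumnorm A.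
Proof. by do 2! apply: sumr_ge0 => ? _; exact: cabs_ge0. Qed.

Lemma cabs_le_sumnorm m n (A : 'M[R[i]]_(m, n)) i j : cabs (A i j) <= sumnorm A.
Proof.
rewrite /sumnorm (bigD1 i) //= (bigD1 j) //= -addrA lerDl.
by apply: addr_ge0; do ! [apply: sumr_ge0 => ? _]; exact: cabs_ge0.
Qed.

Lemma sumnormD m n (A B : 'M[R[i]]_(m, n)) :
  sumnorm (A + B) <= sumnorm A + sumnorm B.
Proof.
rewrite /sumnorm -big_split; apply: ler_sum => i _.
rewrite -big_split; apply: ler_sum => j _.
by rewrite mxE; exact: cabsD.
Qed.

Lemma sumnormN m n (A : 'M[R[i]]_(m, n)) : sumnorm (- A) = sumnorm A.
Proof.
by apply: eq_bigr => i _; apply: eq_bigr => j _; rewrite mxE cabsN.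
Qed.

Lemma sumnorm_distC m n (A B : 'M[R[i]]_(m, n)) :
  sumnorm (A - B) = sumnorm (B - A).
Proof. by rewrite -sumnormN opprB. Qed.

(** Carries estimates from partial sums of the exponential series to the exponential itself, up to
    an arbitrary [e]. *)
Lemma sumnormB_approx m n (X Y X' Y' : 'M[R[i]]_(m, n)) (e : R) :
  sumnorm (X - X') < e / 2 -> sumnorm (Y - Y') < e / 2 ->
  sumnorm (X - Y) <= sumnorm (X' - Y') + e.
Proof.
have -> : X - Y = (X - X') + ((X' - Y') + (Y' - Y)) by rewrite !addrA !subrK.
rewrite (sumnorm_distC Y).
have := sumnormD (X - X') ((X' - Y') + (Y' - Y)).
have := sumnormD (X' - Y') (Y' - Y).
lra.
Qed.

Lemma cabs_entryB_le m n (A B : 'M[R[i]]_(m, n)) i j :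
  cabs (A i j - B i j) <= sumnorm (A - B).
Proof. by apply: le_trans (cabs_le_sumnorm _ i j); rewrite !mxE. Qed.

Lemma sumnorm0 m n : sumnorm (0 : 'M[R[i]]_(m, n)) = 0.
Proof. by rewrite /sumnorm big1 // => i _; rewrite big1 // => j _; rewrite mxE cabs0.
  Qed.

Lemma sumnorm_eq0 m n (A : 'M[R[i]]_(m, n)) : sumnorm A <= 0 -> A = 0.
Proof.
move=> A0; apply/matrixP => i j; rewrite mxE; apply: cabs_eq0.
by apply/eqP; rewrite eq_le cabs_ge0 andbT (le_trans (cabs_le_sumnorm _ _ _) A0).
Qed.

Lemma sumnormZ m n (a : R[i]) (A : 'M[R[i]]_(m, n)) :
  sumnorm (a *: A) = cabs a * sumnorm A.
Proof.
rewrite /sumnorm mulr_sumr; apply: eq_bigr => i _.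
by rewrite mulr_sumr; apply: eq_bigr => j _; rewrite mxE cabsM.
Qed.

Lemma sumnormM m n p (A : 'M[R[i]]_(m, n)) (B : 'M[R[i]]_(n, p)) :
  sumnorm (A *m B) <= sumnorm A * sumnorm B.
Proof.
rewrite /sumnorm mulr_suml; apply: ler_sum => i _.
apply: (@le_trans _ _ (\sum_j \sum_k cabs (A i k) * cabs (B k j))).
  apply: ler_sum => j _; rewrite mxE; apply: le_trans (cabs_sum _ _ _) _.
  by apply: ler_sum => k _; rewrite cabsM.
rewrite exchange_big mulr_suml; apply: ler_sum => k _ /=.
rewrite -mulr_sumr; apply: ler_wpM2l; first exact: cabs_ge0.
(* Row [k] of [B] is only one of the nonnegative contributions to [sumnorm B]. *)
rewrite (bigD1 k) //= lerDl.
by do 2! apply: sumr_ge0 => ? _; exact: cabs_ge0.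
Qed.

Lemma sumnorm_mulmxB m n p (A A' : 'M[R[i]]_(m, n)) (B B' : 'M[R[i]]_(n, p)) :
  sumnorm (A *m B - A' *m B') <=
  sumnorm (A - A') * sumnorm B + sumnorm A' * sumnorm (B - B').
Proof.
have -> : A *m B - A' *m B' = (A - A') *m B + A' *m (B - B').
  by rewrite mulmxBl mulmxBr addrA subrK.
by apply: le_trans (sumnormD _ _) _; apply: lerD; exact: sumnormM.
Qed.

Lemma sumnorm_sum m n (I : Type) (r : seq I) (P : pred I)
    (F : I -> 'M[R[i]]_(m, n)) :
  sumnorm (\sum_(i <- r | P i) F i) <= \sum_(i <- r | P i) sumnorm (F i).
Proof.
elim/big_ind2: _ => [|x1 x2 y1 y2 h1 h2|//]; first by rewrite sumnorm0.
by apply: le_trans (sumnormD _ _) _; exact: lerD.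
Qed.

(** The factor [U] takes care of n = 0: the identity has [sumnorm] equal to its size, so powers
    alone need not satisfy such a bound. *)
Lemma sumnorm_mulX m k (U : 'M[R[i]]_(m, k.+1)) (A : 'M[R[i]]_k.+1) n :
  sumnorm (U *m A ^+ n) <= sumnorm U * sumnorm A ^+ n.
Proof.
elim: n => [|n IH]; first by rewrite !expr0 mulmx1 mulr1.
rewrite exprSr -mulmxE mulmxA exprSr mulrA.
apply: le_trans (sumnormM _ _) _.
by apply: ler_wpM2r; first exact: sumnorm_ge0.
Qed.

Lemma mx_norm_lt m n (A : 'M[R[i]]_(m, n)) (e : R) :
  sumnorm A < e -> `|A| < e%:C.
Proof.
move=> Ae; rewrite [ltLHS](_ : _ = mx_norm A) //.
have [->|/mx_norm_neq0[i ->]] := eqVneq (mx_norm A) 0.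
  by rewrite -[0]/(0%:C) ltcR (le_lt_trans (sumnorm_ge0 A)).
by rewrite normc_cabs ltcR (le_lt_trans (cabs_le_sumnorm _ _ _) Ae).
Qed.

End SumNorm.

(** * The matrix exponential: convergence, Lipschitz bounds, conjugation *)

Section MatrixExponential.
Context {R : realType} {k : nat}.
Implicit Types A B : 'M[R[i]]_k.+1.

Definition mexp_series A : nat -> 'M[R[i]]_k.+1 :=
  series (fun j : nat => (j`!%:R)^-1 *: A ^+ j).

Lemma mexp_seriesS A n :
  mexp_series A n.+1 = mexp_series A n + (n`!%:R)^-1 *: A ^+ n.
Proof. by rewrite /mexp_series /series /= big_nat_recr. Qed.

Lemma mexp_series0 A : mexp_series A 0 = 0.
Proof. by rewrite /mexp_series /series /= big_geq. Qed.

Lemma cabs_invfact n : cabs ((n`!%:R)^-1 : R[i]) = (n`!%:R)^-1.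
Proof.
by rewrite -(rmorph_nat (real_complex R)) -fmorphV cabs_real ger0_norm ?invr_ge0.
Qed.

Lemma exp_partial_le_expR (x : R) n :
  0 <= x -> \sum_(0 <= j < n) (j`!%:R)^-1 * x ^+ j <= expR x.
Proof.
move=> x0; rewrite /expR; set u := exp_coeff x.
rewrite [leLHS](_ : _ = series u n); last first.
  by apply: eq_bigr => j _; rewrite mulrC.
apply: nondecreasing_cvgn_le; last exact: is_cvg_series_exp_coeff.
by apply: nondecreasing_series => j _ _; exact: exp_coeff_ge0.
Qed.

(** Each entry of the series is dominated by a multiple of the real series for exp([sumnorm A]). The
    matrix [L] of the entrywise limits is then the limit in the normed space of matrices as well,
    hence equals [mexp A]. *)
Lemma mexp_cvg A : sumnorm (mexp A - mexp_series A n) @[n --> \oo] --> 0.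
Proof.
pose v (n : nat) := sumnorm (1%:M : 'M[R[i]]_k.+1) * exp_coeff (sumnorm A) n.
have vE n : sumnorm ((n`!%:R)^-1 *: A ^+ n) <= v n.
  rewrite sumnormZ cabs_invfact /v /exp_coeff /= mulrA [leRHS]mulrC.
  rewrite ler_wpM2l ?invr_ge0 // -[X in sumnorm X <= _]mul1mx.
  exact: sumnorm_mulX.
have cv : cvgn (series v).
  rewrite (_ : series v = fun n => sumnorm (1%:M : 'M[R[i]]_k.+1) *
    series (exp_coeff (sumnorm A)) n); last first.
    by apply/funext => n; rewrite /series /= mulr_sumr.
  by apply: is_cvgMr; exact: is_cvg_series_exp_coeff.
have entry i j := complex_series_cvg
  (u := fun n => ((n`!%:R)^-1 *: A ^+ n) i j)
  (fun n => le_trans (cabs_le_sumnorm _ i j) (vE n)) cv.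
pose L : 'M[R[i]]_k.+1 := \matrix_(i, j) projT1 (cid (entry i j)).
have hL : sumnorm (L - mexp_series A n) @[n --> \oo] --> 0.
  rewrite [X in _ --> X](_ : 0 = \sum_(i < k.+1) \sum_(j < k.+1) (0 : R)); last first.
    by rewrite big1 // => i _; rewrite big1.
  apply: cvg_big => [|i _]; first exact: add_continuous.
  apply: cvg_big => [|j _]; first exact: add_continuous.
  have h := projT2 (cid (entry i j)).
  apply: cvg_trans h; apply: near_eq_cvg; near=> n.
  by rewrite !mxE /mexp_series /series /= summxE.
suff -> : mexp A = L by [].
pose V : normedModType R[i] := 'M[R[i]]_k.+1.
rewrite /mexp; apply: (@cvg_lim V); first exact: norm_hausdorff.
apply/(@cvgrPdist_lt _ V) => e e0.
(* The norm of this space lives in R[i], where a positive [e] is necessarily real. *)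
have eE : e = (complex.Re e)%:C by rewrite RRe_real ?gtr0_real.
have Re_gt0 : 0 < complex.Re e by rewrite -ltcR -eE.
apply: filterS (@cvgr0_norm_lt R R^o _ _ _ _ hL _ Re_gt0) => n hn.
by rewrite eE mx_norm_lt // (le_lt_trans (ler_norm _) hn).
Unshelve. all: by end_near. Qed.

Lemma mexp_approx A (e : R) : 0 < e ->
  \forall n \near \oo, sumnorm (mexp A - mexp_series A n) < e.
Proof.
move=> e0.
apply: filterS (@cvgr0_norm_lt R R^o _ _ _ _ (@mexp_cvg A) _ e0) => n.
exact: le_lt_trans (ler_norm _).
Qed.

(** Induction on A^(n+1) - B^(n+1) = A (A^n - B^n) + (A - B) B^n. At n = 0 the factor [n%:R]
    vanishes, so the truncated exponent [n.-1] is harmless. *)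
Lemma sumnorm_powerB A B (M : R) n :
  sumnorm A <= M -> sumnorm B <= M ->
  sumnorm (A ^+ n - B ^+ n) <= n%:R * M ^+ n.-1 * sumnorm (A - B).
Proof.
move=> AM BM; have M0 : 0 <= M by exact: le_trans (sumnorm_ge0 A) AM.
elim: n => [|n IH]; first by rewrite !expr0 subrr sumnorm0 mul0r mul0r.
have -> : A ^+ n.+1 - B ^+ n.+1 = A *m (A ^+ n - B ^+ n) + (A - B) *m B ^+ n.
  by rewrite mulmxBr mulmxBl !mulmxE !exprS addrA subrK.
apply: le_trans (sumnormD _ _) _; rewrite /=.
have h1 : sumnorm (A *m (A ^+ n - B ^+ n)) <= n%:R * M ^+ n * sumnorm (A - B).
  apply: le_trans (sumnormM _ _) _.
  apply: le_trans (ler_pM (sumnorm_ge0 _) (sumnorm_ge0 _) AM IH) _.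
  rewrite !mulrA; case: n {IH} => [|n]; first by rewrite mulr0 !mul0r.
  by rewrite le_eqVlt; apply/orP; left; apply/eqP; rewrite exprS /=; ring.
have h2 : sumnorm ((A - B) *m B ^+ n) <= M ^+ n * sumnorm (A - B).
  apply: le_trans (sumnorm_mulX _ _ _) _; rewrite mulrC.
  rewrite ler_wpM2r ?sumnorm_ge0 //.
  by apply: lerXn2r; rewrite // ?nnegrE ?sumnorm_ge0.
apply: le_trans (lerD h1 h2) _.
by rewrite -natr1 mulrDl mul1r mulrDl.
Qed.

Lemma mexp_seriesB A B (M : R) n :
  sumnorm A <= M -> sumnorm B <= M ->
  sumnorm (mexp_series A n - mexp_series B n) <= expR M * sumnorm (A - B).
Proof.
move=> AM BM; have M0 : 0 <= M by exact: le_trans (sumnorm_ge0 A) AM.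
case: n => [|n]; first by rewrite !mexp_series0 subrr sumnorm0 mulr_ge0 ?expR_ge0
  ?sumnorm_ge0.
rewrite /mexp_series /series /= -sumrB.
apply: le_trans (sumnorm_sum _ _ _) _.
apply: (@le_trans _ _ ((\sum_(0 <= j < n) (j`!%:R)^-1 * M ^+ j) * sumnorm (A - B)));
  last first.
  by rewrite ler_wpM2r ?sumnorm_ge0 ?exp_partial_le_expR.
(* The identity terms cancel; after the index shift, (j+1) M^j / (j+1)! = M^j / j!, whose partial
   sums stay below exp(M). *)
rewrite big_nat_recl //= !expr0 -scalerBr subrr scaler0 sumnorm0 add0r mulr_suml.
apply: ler_sum_nat => j _; rewrite -scalerBr sumnormZ cabs_invfact.
have := sumnorm_powerB j.+1 AM BM => /= h.
have f0 : 0 <= (j.+1`!%:R)^-1 :> R by rewrite invr_ge0.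
apply: le_trans (ler_wpM2l f0 h) _.
rewrite factS natrM !mulrA invfM ler_wpM2r ?sumnorm_ge0 // ler_wpM2r ?exprn_ge0 //.
by rewrite mulrAC mulVf ?mul1r // pnatr_eq0.
Qed.

Lemma sumnorm_mexpB A B (M : R) :
  sumnorm A <= M -> sumnorm B <= M ->
  sumnorm (mexp A - mexp B) <= expR M * sumnorm (A - B).
Proof.
move=> AM BM; apply/ler_addgt0Pr => e e0.
have e2 : 0 < e / 2 by rewrite divr_gt0.
have [n [/= hA hB]] := filter_ex (filterI (mexp_approx A e2) (mexp_approx B e2)).
apply: le_trans (sumnormB_approx hA hB) _.
by rewrite lerD2r; exact: mexp_seriesB.
Qed.

(** In the series of U exp(A) - U every term contains the factor U A, so a small U A suffices even
    if A is not small. Taking for [U] the unit row that selects the third row yields the quadratic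
    rate for Q. *)
Lemma sumnorm_mul_mexpB m (U : 'M[R[i]]_(m, k.+1)) A :
  sumnorm (U *m mexp A - U) <= expR (sumnorm A) * sumnorm (U *m A).
Proof.
apply/ler_addgt0Pr => e e0.
(* The added 1 allows division when [U] is zero. *)
pose u := sumnorm U + 1.
have u0 : 0 < u by rewrite ltr_wpDl ?sumnorm_ge0.
have eu0 : 0 < e / u by rewrite divr_gt0.
have [[|n] [/= hA //]] := filter_ex (filterI (mexp_approx A eu0) (nbhs_infty_gt 0)).
move=> _.
have -> : U *m mexp A - U =
    (U *m mexp_series A n.+1 - U) + U *m (mexp A - mexp_series A n.+1).
  by rewrite mulmxBr; move: (U *m _) (U *m _) => X Y; rewrite [RHS]addrC addrA subrK.
apply: le_trans (sumnormD _ _) _; apply: lerD; last first.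
  apply: le_trans (sumnormM _ _) _.
  apply: (@le_trans _ _ (u * (e / u))); last by rewrite mulrC divfK ?gt_eqF.
  by apply: ler_pM; rewrite ?sumnorm_ge0 ?lerDl // ltW.
(* The term j = 0 is [U] and cancels; the others are U A A^j / (j+1)!, and 1/(j+1)! <= 1/j!. *)
rewrite /mexp_series /series /= big_nat_recl //= expr0 invr1 scale1r.
rewrite mulmxDr mulmx1 addrC addKr mulmx_sumr.
apply: le_trans (sumnorm_sum _ _ _) _.
apply: (@le_trans _ _ ((\sum_(0 <= j < n) (j`!%:R)^-1 * sumnorm A ^+ j) * sumnorm (U
  *m A))); last first.
  by rewrite ler_wpM2r ?sumnorm_ge0 ?exp_partial_le_expR ?sumnorm_ge0.
rewrite mulr_suml; apply: ler_sum_nat => j _.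
rewrite -scalemxAr sumnormZ cabs_invfact -mulrA.
apply: ler_pM; rewrite ?invr_ge0 ?sumnorm_ge0 //.
  by rewrite lef_pV2 ?posrE ?ltr0n ?fact_gt0 // ler_nat factS leq_pmull.
by rewrite exprS -mulmxE mulmxA mulrC; exact: sumnorm_mulX.
Qed.

Lemma sumnorm_mexp_le A (M : R) : sumnorm A <= M ->
  sumnorm (mexp A) <= sumnorm (1%:M : 'M[R[i]]_k.+1) + expR M * M.
Proof.
move=> AM; have := sumnorm_mul_mexpB 1%:M A; rewrite !mul1mx => h.
have := sumnormD 1%:M (mexp A - 1%:M); rewrite addrC subrK => h'.
apply: le_trans h' _; rewrite lerD2l; apply: le_trans h _.
by apply: ler_pM; rewrite ?expR_ge0 ?sumnorm_ge0 ?ler_expR.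
Qed.

(** The relation passes to powers and so holds exactly for partial sums; the two tails, multiplied
    by [S], are arbitrarily small. *)
Lemma mexp_intertwine A B S : A *m S = S *m B -> mexp A *m S = S *m mexp B.
Proof.
move=> AS; apply/eqP; rewrite -subr_eq0; apply/eqP/sumnorm_eq0.
apply/ler_addgt0Pr => e e0; rewrite add0r.
pose s := sumnorm S + 1.
have s0 : 0 < s by rewrite ltr_wpDl ?sumnorm_ge0.
have e2 : 0 < e / 2 / s by rewrite !divr_gt0.
have [n [/= hA hB]] := filter_ex (filterI (mexp_approx A e2) (mexp_approx B e2)).
have SAB : mexp_series A n *m S = S *m mexp_series B n.
  rewrite /mexp_series /series /= mulmx_suml mulmx_sumr; apply: eq_bigr => j _.
  rewrite -scalemxAl -scalemxAr; congr (_ *: _).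
  elim: j => [|j IH]; first by rewrite !expr0 mul1mx mulmx1.
  by rewrite !exprS -!mulmxE -mulmxA IH !mulmxA AS.
have -> : mexp A *m S - S *m mexp B =
    (mexp A - mexp_series A n) *m S - S *m (mexp B - mexp_series B n).
  rewrite mulmxBl mulmxBr SAB opprB.
  by move: (mexp A *m S) (S *m _) (S *m _) => X Y Z; rewrite addrA subrK.
have bound x : 0 <= x < e / 2 / s -> x * sumnorm S <= e / 2.
  move=> /andP[x0 /ltW xe].
  rewrite -(divfK (lt0r_neq0 s0) (e / 2)).
  by apply: ler_pM; rewrite ?sumnorm_ge0 ?lerDl.
apply: le_trans (sumnormD _ _) _; rewrite sumnormN [leRHS]splitr; apply: lerD.
  by apply: le_trans (sumnormM _ _) _; apply: bound; rewrite sumnorm_ge0 hA.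
apply: le_trans (sumnormM _ _) _; rewrite mulrC.
by apply: bound; rewrite sumnorm_ge0 hB.
Qed.

Lemma mexp_nilpotent A m : A ^+ m = 0 -> mexp A = mexp_series A m.
Proof.
move=> Am; apply/eqP; rewrite -subr_eq0; apply/eqP/sumnorm_eq0.
apply/ler_addgt0Pr => e e0; rewrite add0r.
near \oo => n.
have -> : mexp_series A m = mexp_series A n.
  have mn : (m <= n)%N by near: n; exact: nbhs_infty_ge.
  rewrite -(subnKC mn); elim: (n - m)%N => [|j IH]; first by rewrite addn0.
  by rewrite addnS mexp_seriesS exprD Am mul0r scaler0 addr0.
by apply/ltW; near: n; exact: mexp_approx.
Unshelve. all: by end_near. Qed.

End MatrixExponential.

(** * Perturbation of an invertible linear system *)

Section InversePerturbation.
Context {R : realType} {n : nat}.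
Implicit Types B G : 'M[R[i]]_n.

Lemma sumnorm_contract m (u v : 'cV[R[i]]_m) (X : 'M[R[i]]_m) :
  sumnorm X <= 2^-1 -> u = v - X *m u -> sumnorm u <= 2 * sumnorm v.
Proof.
move=> X2 uE; have : sumnorm u <= sumnorm v + sumnorm X * sumnorm u.
  by rewrite {1}uE; apply: le_trans (sumnormD _ _) _; rewrite sumnormN lerD2l sumnormM.
have := ler_wpM2r (sumnorm_ge0 u) X2; lra.
Qed.

(** If B u = 0 then u = - G (B - B0) u, and the contraction bound forces u = 0. The row-space
    criterion for invertibility is applied to the transpose of [B]. *)
Lemma perturbed_unitmx B0 B G :
  G *m B0 = 1%:M -> sumnorm (G *m (B - B0)) <= 2^-1 -> B \in unitmx.
Proof.
move=> GB0 small; rewrite -unitmx_tr -row_free_unit; apply: inj_row_free => v vB.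
have Bv : B *m v^T = 0 by rewrite -[B]trmxK -trmx_mul vB trmx0.
have vE : v^T = 0 - G *m (B - B0) *m v^T.
  by rewrite -mulmxA mulmxBl Bv !sub0r mulmxN opprK mulmxA GB0 mul1mx.
have := sumnorm_contract small vE.
rewrite sumnorm0 mulr0 => /sumnorm_eq0 v0.
by rewrite -[v]trmxK v0 trmx0.
Qed.

(** The solution satisfies w = G f - G (B - B0) w, so the error is G (B - B0) w, and contraction
    bounds w by twice the norm of G f. *)
Lemma perturbed_solution B0 B G (f : 'cV[R[i]]_n) :
  G *m B0 = 1%:M -> sumnorm (G *m (B - B0)) <= 2^-1 ->
  sumnorm (invmx B *m f - G *m f) <=
    sumnorm (G *m (B - B0)) * (2 * sumnorm (G *m f)).
Proof.
move=> GB0 small; set w := invmx B *m f.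
have wE : w = G *m f - G *m (B - B0) *m w.
  rewrite -mulmxA mulmxBl mulmxBr [B *m w]mulmxA.
  rewrite mulmxV ?(perturbed_unitmx GB0) // mul1mx.
  by rewrite mulmxA GB0 mul1mx opprB addrC subrK.
rewrite {1}wE addrAC subrr add0r sumnormN.
apply: le_trans (sumnormM _ _) _.
by rewrite ler_wpM2l ?sumnorm_ge0 ?(sumnorm_contract small wE).
Qed.

End InversePerturbation.

(** * Calculus with explicit 4 x 4 matrices *)

Section ExplicitMatrices.
Context {R : realType}.

Lemma mx4_eq (A B : 'M[R[i]]_4) :
  (forall i j : nat, (i < 4)%N -> (j < 4)%N ->
    A (inord i) (inord j) = B (inord i) (inord j)) -> A = B.
Proof.
move=> AB; apply/matrixP => i j.
by have := AB i j (ltn_ord i) (ltn_ord j); rewrite !inord_val.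
Qed.

Lemma mx4E (rows : seq (seq R[i])) i j : (i < 4)%N -> (j < 4)%N ->
  mx4 rows (inord i) (inord j) = nth 0 (nth [::] rows i) j.
Proof. by move=> i4 j4; rewrite mxE !inordK. Qed.

Lemma sum4E (V : nmodType) (F : 'I_4 -> V) :
  \sum_i F i = F (inord 0) + F (inord 1) + F (inord 2) + F (inord 3).
Proof.
rewrite !big_ord_recl big_ord0 addr0 !addrA.
by do ![congr (_ + _)]; congr F; apply: val_inj; rewrite /= inordK.
Qed.

Lemma mx4M a00 a01 a02 a03 a10 a11 a12 a13 a20 a21 a22 a23 a30 a31 a32 a33 b00 b01
  b02 b03 b10 b11 b12 b13 b20 b21 b22 b23 b30 b31 b32 b33 :
  mx4 [:: [:: a00; a01; a02; a03];
      [:: a10; a11; a12; a13];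
      [:: a20; a21; a22; a23];
      [:: a30; a31; a32; a33]] *m
  mx4 [:: [:: b00; b01; b02; b03];
      [:: b10; b11; b12; b13];
      [:: b20; b21; b22; b23];
      [:: b30; b31; b32; b33]] =
  mx4 [:: [:: a00 * b00 + a01 * b10 + a02 * b20 + a03 * b30;
               a00 * b01 + a01 * b11 + a02 * b21 + a03 * b31;
               a00 * b02 + a01 * b12 + a02 * b22 + a03 * b32;
               a00 * b03 + a01 * b13 + a02 * b23 + a03 * b33];
          [:: a10 * b00 + a11 * b10 + a12 * b20 + a13 * b30;
               a10 * b01 + a11 * b11 + a12 * b21 + a13 * b31;
               a10 * b02 + a11 * b12 + a12 * b22 + a13 * b32;
               a10 * b03 + a11 * b13 + a12 * b23 + a13 * b33];
          [:: a20 * b00 + a21 * b10 + a22 * b20 + a23 * b30;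
               a20 * b01 + a21 * b11 + a22 * b21 + a23 * b31;
               a20 * b02 + a21 * b12 + a22 * b22 + a23 * b32;
               a20 * b03 + a21 * b13 + a22 * b23 + a23 * b33];
          [:: a30 * b00 + a31 * b10 + a32 * b20 + a33 * b30;
               a30 * b01 + a31 * b11 + a32 * b21 + a33 * b31;
               a30 * b02 + a31 * b12 + a32 * b22 + a33 * b32;
               a30 * b03 + a31 * b13 + a32 * b23 + a33 * b33]] :> 'M[R[i]]_4.
Proof.
apply: mx4_eq => i j i4 j4; rewrite mxE sum4E !mx4E //.
by case: i i4 => [|[|[|[|//]]]] _; case: j j4 => [|[|[|[|//]]]].
Qed.

Lemma mx4D a00 a01 a02 a03 a10 a11 a12 a13 a20 a21 a22 a23 a30 a31 a32 a33 b00 b01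
  b02 b03 b10 b11 b12 b13 b20 b21 b22 b23 b30 b31 b32 b33 :
  mx4 [:: [:: a00; a01; a02; a03];
      [:: a10; a11; a12; a13];
      [:: a20; a21; a22; a23];
      [:: a30; a31; a32; a33]] +
  mx4 [:: [:: b00; b01; b02; b03];
      [:: b10; b11; b12; b13];
      [:: b20; b21; b22; b23];
      [:: b30; b31; b32; b33]] =
  mx4 [:: [:: a00 + b00; a01 + b01; a02 + b02; a03 + b03];
      [:: a10 + b10; a11 + b11; a12 + b12; a13 + b13];
      [:: a20 + b20; a21 + b21; a22 + b22; a23 + b23];
      [:: a30 + b30; a31 + b31; a32 + b32; a33 + b33]] :> 'M[R[i]]_4.
Proof.
apply: mx4_eq => i j i4 j4; rewrite mxE !mx4E //.
by case: i i4 => [|[|[|[|//]]]] _; case: j j4 => [|[|[|[|//]]]].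
Qed.

Lemma mx4Z x a00 a01 a02 a03 a10 a11 a12 a13 a20 a21 a22 a23 a30 a31 a32 a33 :
  x *: mx4 [:: [:: a00; a01; a02; a03];
      [:: a10; a11; a12; a13];
      [:: a20; a21; a22; a23];
      [:: a30; a31; a32; a33]] =
  mx4 [:: [:: x * a00; x * a01; x * a02; x * a03];
      [:: x * a10; x * a11; x * a12; x * a13];
      [:: x * a20; x * a21; x * a22; x * a23];
      [:: x * a30; x * a31; x * a32; x * a33]] :> 'M[R[i]]_4.
Proof.
apply: mx4_eq => i j i4 j4; rewrite mxE !mx4E //.
by case: i i4 => [|[|[|[|//]]]] _; case: j j4 => [|[|[|[|//]]]].
Qed.

Lemma mx4_0 : 0 = mx4 [:: [:: 0; 0; 0; 0];
      [:: 0; 0; 0; 0];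
      [:: 0; 0; 0; 0];
      [:: 0; 0; 0; 0]] :> 'M[R[i]]_4.
Proof.
apply: mx4_eq => i j i4 j4; rewrite mxE !mx4E //.
by case: i i4 => [|[|[|[|//]]]] _; case: j j4 => [|[|[|[|//]]]].
Qed.

Lemma mx4_1 : 1%:M = mx4 [:: [:: 1; 0; 0; 0];
      [:: 0; 1; 0; 0];
      [:: 0; 0; 1; 0];
      [:: 0; 0; 0; 1]] :> 'M[R[i]]_4.
Proof.
apply: mx4_eq => i j i4 j4; rewrite mxE !mx4E // -val_eqE /= !inordK //.
by case: i i4 => [|[|[|[|//]]]] _; case: j j4 => [|[|[|[|//]]]].
Qed.

Lemma mx4_e4 (rows : seq (seq R[i])) i : (i < 4)%N ->
  (mx4 rows *m (delta_mx (inord 3) 0 : 'cV_4)) (inord i) 0 = nth 0 (nth [::] rows i) 3.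
Proof.
move=> i4; rewrite mxE sum4E !mx4E // !mxE -!val_eqE /= !inordK //.
by rewrite !mulr0 mulr1 !add0r.
Qed.

End ExplicitMatrices.

(** Reduces an identity between explicit matrices to sixteen scalar identities. *)
Ltac mx4_congr :=
  rewrite ?(mx4_0, mx4_1) ?(mx4M, mx4D, mx4Z);
  congr (mx4 [:: [:: _; _; _; _]; [:: _; _; _; _]; [:: _; _; _; _]; [:: _; _; _; _]]);
  rewrite ?(mul0r, mulr0, mul1r, mulr1, add0r, addr0).

(** * The rescaled system and its limit at rho = 0 *)

Section RescaledSystem.
Context {R : realType}.
Implicit Types (rho x b : R) (c : R[i]).

(* The weights of S are the orders in rho of the components of y; those of T are
   chosen so that T^-1 (M + N exp(b A)) S has a finite invertible limit. *)
Definition scaleS rho : 'M[R[i]]_4 :=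
  mx4 [:: [:: rho%:C; 0; 0; 0]; [:: 0; rho%:C ^+ 2; 0; 0];
          [:: 0; 0; 1; 0]; [:: 0; 0; 0; rho%:C]].

Definition scaleT rho : 'M[R[i]]_4 :=
  mx4 [:: [:: rho%:C; 0; 0; 0]; [:: 0; rho%:C ^+ 2; 0; 0];
          [:: 0; 0; rho%:C; 0]; [:: 0; 0; 0; 1]].

(** S^-1 A S with the powers of rho cancelled, so that it makes sense at rho = 0. Keeping [c] as a
    separate parameter makes the limit the value at (0, 0). *)
Definition rescaledA rho c : 'M[R[i]]_4 :=
  mx4 [:: [:: 0; 0; 0; 1];
          [:: - (2 * pi)%:C; 0; 0; 0];
          [:: 0; - (c * rho%:C ^+ 2); 0; - (2 * pi * rho ^+ 2)%:C];
          [:: c; 0; - (2 * pi)%:C; 0]].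

(** T^-1 N S, again with the powers of rho cancelled. *)
Definition rescaledN rho : 'M[R[i]]_4 :=
  mx4 [:: [:: 0; 0; 0; 0];
          [:: 0; 0; 0; 0];
          [:: 0; (2 * pi * rho ^+ 2)%:C; 0; - 1];
          [:: (4 * pi * rho ^+ 2)%:C; 0; 1; 0]].

Definition rescaledB b rho c : 'M[R[i]]_4 :=
  matM R + rescaledN rho *m mexp (b%:C *: rescaledA rho c).

Definition rescaled_init b rho c : 'cV[R[i]]_4 :=
  invmx (rescaledB b rho c) *m delta_mx (inord 3) 0.

Definition rescaled_sol b rho c x : 'cV[R[i]]_4 :=
  mexp (x%:C *: rescaledA rho c) *m rescaled_init b rho c.

Lemma matA_scale d (xi : 'rV[R]_d.+1) gamma :
  matA xi gamma *m scaleS (enorm xi) =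
  scaleS (enorm xi) *m rescaledA (enorm xi) (coefA xi gamma).
Proof. rewrite /matA /rescaledA; set c := coefA _ _; set r := enorm _; clearbody c r.
  by mx4_congr; ring. Qed.

Lemma matN_scale d (xi : 'rV[R]_d.+1) :
  matN xi *m scaleS (enorm xi) = scaleT (enorm xi) *m rescaledN (enorm xi).
Proof. by rewrite /matN; set r := enorm _; clearbody r; mx4_congr; ring. Qed.

Lemma matM_scale rho : matM R *m scaleS rho = scaleT rho *m matM R.
Proof. by mx4_congr; ring. Qed.

Lemma scaleT_e4 rho : scaleT rho *m delta_mx (inord 3) 0 =
  delta_mx (inord 3) 0 :> 'cV[R[i]]_4.
Proof.
apply/matrixP => i j; rewrite !ord1 -(inord_val i) mx4_e4 //.
case: i => [[|[|[|[|//]]]] ?]; by rewrite mxE -!val_eqE /= !inordK.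
Qed.

Lemma scaleT_unit rho : rho != 0 -> scaleT rho \in unitmx.
Proof.
move=> r0; have rC : rho%:C != 0 by rewrite -[0]/(0%:C) (inj_eq (@complexI _)).
suff /mulmx1_unit[] : scaleT rho *m mx4 [::
    [:: rho%:C^-1; 0; 0; 0]; [:: 0; rho%:C ^-2; 0; 0];
    [:: 0; 0; rho%:C^-1; 0]; [:: 0; 0; 0; 1]] = 1%:M by [].
by mx4_congr; field.
Qed.

Lemma mexp_matA_scale d (xi : 'rV[R]_d.+1) gamma x :
  mexp (x%:C *: matA xi gamma) *m scaleS (enorm xi) =
  scaleS (enorm xi) *m mexp (x%:C *: rescaledA (enorm xi) (coefA xi gamma)).
Proof. by apply: mexp_intertwine; rewrite -scalemxAl -scalemxAr matA_scale. Qed.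

Lemma matB_scale d b (xi : 'rV[R]_d.+1) gamma :
  matB b xi gamma *m scaleS (enorm xi) =
  scaleT (enorm xi) *m rescaledB b (enorm xi) (coefA xi gamma).
Proof.
rewrite mulmxDl mulmxDr matM_scale -mulmxA mexp_matA_scale.
by rewrite !mulmxA matN_scale.
Qed.

(** From B S = T B' and T e_4 = e_4, the vector S B'^-1 e_4 solves B v = e_4; then exp(x A) S = S
    exp(x A'). Invertibility of B follows from that of T and B'. *)
Lemma soly_scale d b (xi : 'rV[R]_d.+1) x gamma :
  enorm xi != 0 -> rescaledB b (enorm xi) (coefA xi gamma) \in unitmx ->
  soly b xi x gamma =
  scaleS (enorm xi) *m rescaled_sol b (enorm xi) (coefA xi gamma) x.
Proof.
move=> xi0 uB; set e4 : 'cV[R[i]]_4 := delta_mx (inord 3) 0.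
have uB' : matB b xi gamma \in unitmx.
  have : matB b xi gamma *m scaleS (enorm xi) \in unitmx.
    by rewrite matB_scale unitmx_mul scaleT_unit.
  by rewrite unitmx_mul => /andP[].
have Sw : matB b xi gamma *m
    (scaleS (enorm xi) *m rescaled_init b (enorm xi) (coefA xi gamma)) = e4.
  by rewrite mulmxA matB_scale -mulmxA (mulKVmx uB) scaleT_e4.
rewrite /soly /rescaled_sol mulmxA -mexp_matA_scale -!mulmxA -/e4 -[in LHS]Sw.
by rewrite (mulKmx uB').
Qed.

Definition limitE x : 'M[R[i]]_4 :=
  mx4 [:: [:: 1; 0; - (pi * x ^+ 2)%:C; x%:C];
          [:: - (2 * pi * x)%:C; 1; (2 * pi ^+ 2 * x ^+ 3 / 3)%:C; - (pi * x ^+ 2)%:C];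
          [:: 0; 0; 1; 0];
          [:: 0; 0; - (2 * pi * x)%:C; 1]].

(** The limit matrix has fourth power zero, so its exponential series stops after the cubic term. *)
Lemma mexp_rescaledA0 x : mexp (x%:C *: rescaledA 0 0) = limitE x.
Proof.
set A := _ *: _.
have A2 : A *m A = (x ^+ 2)%:C *: mx4 [:: [:: 0; 0; - (2 * pi)%:C; 0];
   [:: 0; 0; 0; - (2 * pi)%:C]; [:: 0; 0; 0; 0]; [:: 0; 0; 0; 0]].
  by rewrite /A /rescaledA; mx4_congr; ring.
have A3 : A *m (A *m A) = (x ^+ 3)%:C *: mx4 [:: [:: 0; 0; 0; 0];
   [:: 0; 0; (4 * pi ^+ 2)%:C; 0]; [:: 0; 0; 0; 0]; [:: 0; 0; 0; 0]].
  by rewrite A2 /A /rescaledA; mx4_congr; ring.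
have A4 : A *m (A *m (A *m A)) = 0.
  by rewrite A3 /A /rescaledA; mx4_congr; ring.
rewrite (@mexp_nilpotent _ _ _ 4); last by rewrite !exprS expr0 mulr1 -!mulmxE.
rewrite !mexp_seriesS mexp_series0 !exprS expr0 mulr1 -!mulmxE -idmxE A3 A2.
have [f0 f1 f2 f3] : [/\ 0`! = 1, 1`! = 1, 2`! = 2 & 3`! = 6]%N by [].
rewrite f3 f2 f1 f0 invr1 !scale1r.
rewrite /A /rescaledA /limitE; mx4_congr. all: by field.
Qed.

Definition limitBinv b : 'M[R[i]]_4 :=
  mx4 [:: [:: 1; 0; 0; 0]; [:: 0; 1; 0; 0];
          [:: 0; 0; 0; 1]; [:: 0; 0; - 1; (2 * pi * b)%:C]].

Lemma limitBinvP b : limitBinv b *m rescaledB b 0 0 = 1%:M.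
Proof.
rewrite /rescaledB mexp_rescaledA0.
have -> : matM R + rescaledN 0 *m limitE b = mx4 [:: [:: 1; 0; 0; 0];
   [:: 0; 1; 0; 0]; [:: 0; 0; (2 * pi * b)%:C; - 1]; [:: 0; 0; 1; 0]].
  by rewrite /matM /rescaledN /limitE; mx4_congr; ring.
by rewrite /limitBinv; mx4_congr; ring.
Qed.

(** The initial vector here is (0, 0, 1, 2 pi b), the last column of [limitBinv b]. *)
Definition limit_sol b x : 'cV[R[i]]_4 :=
  limitE x *m (limitBinv b *m delta_mx (inord 3) 0).

End RescaledSystem.

(** * Rates of convergence of the rescaled matrices *)

Section RescaledEstimates.
Context {R : realType}.
Implicit Types (rho x b C : R) (c : R[i]).

Lemma sumnorm_mx4 (rows : seq (seq R[i])) : sumnorm (mx4 rows) =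
  \sum_(i < 4) \sum_(j < 4) cabs (nth 0 (nth [::] rows i) j).
Proof. by apply: eq_bigr => i _; apply: eq_bigr => j _; rewrite mxE. Qed.

Lemma rescaledA_near rho c C : 0 <= rho <= 1 -> cabs c <= C * rho ->
  sumnorm (rescaledA rho c - rescaledA 0 0) <= (2 * C + 2 * pi) * rho.
Proof.
move=> /andP[r0 r1] cC; have pi0 := pi_ge0 R.
have -> : rescaledA rho c - rescaledA 0 0 = mx4 [::
    [:: 0; 0; 0; 0]; [:: 0; 0; 0; 0];
    [:: 0; - (c * rho%:C ^+ 2); 0; - (2 * pi * rho ^+ 2)%:C]; [:: c; 0; 0; 0]].
  by rewrite -scaleN1r /rescaledA; mx4_congr; ring.
rewrite sumnorm_mx4 !big_ord_recl !big_ord0 /= !cabs0 !addr0 !add0r !cabsN !cabsM.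
rewrite !cabs_real !ger0_norm ?mulr_ge0 //.
have h : cabs c * (rho * rho) <= C * rho.
  rewrite -[leRHS]mulr1; apply: ler_pM; rewrite ?cabs_ge0 ?mulr_ge0 //.
  by apply: mulr_ile1.
have : 2 * pi * rho ^+ 2 <= 2 * pi * rho.
  by rewrite ler_wpM2l ?mulr_ge0 // expr2 ler_piMr.
lra.
Qed.

(** Both nonzero entries of this row carry rho^2; this is the source of the better rate for Q. *)
Lemma sumnorm_rescaledA_row3 rho c C : 0 <= C -> 0 <= rho <= 1 -> cabs c <= C * rho ->
  sumnorm (delta_mx 0 (inord 2) *m rescaledA rho c : 'rV_4)
    <= (C + 2 * pi) * rho ^+ 2.
Proof.
move=> C0 /andP[r0 r1] cC; have pi0 := pi_ge0 R.
rewrite -rowE /sumnorm big_ord1 sum4E !mxE !inordK //= !cabs0 !addr0 !add0r.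
rewrite !cabsN !cabsM !cabs_real !ger0_norm ?mulr_ge0 // [leRHS]mulrDl.
rewrite -!expr2 lerD2r ler_wpM2r ?exprn_ge0 //.
apply: le_trans cC _; exact: ler_piMr.
Qed.

Lemma rescaledN_near rho : 0 <= rho <= 1 ->
  sumnorm (rescaledN rho - rescaledN 0) <= 6 * pi * rho.
Proof.
move=> /andP[r0 r1]; have pi0 := pi_ge0 R.
have -> : rescaledN rho - rescaledN 0 = mx4 [::
    [:: 0; 0; 0; 0]; [:: 0; 0; 0; 0];
    [:: 0; (2 * pi * rho ^+ 2)%:C; 0; 0];
    [:: (4 * pi * rho ^+ 2)%:C; 0; 0; 0]].
  by rewrite -scaleN1r /rescaledN; mx4_congr; ring.
rewrite sumnorm_mx4 !big_ord_recl !big_ord0 /= !cabs0 !addr0 !add0r.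
rewrite !cabs_real !ger0_norm ?mulr_ge0 //.
have : pi * rho ^+ 2 <= pi * rho by rewrite ler_wpM2l // expr2 ler_piMr.
lra.
Qed.

(* Fourth row of the system [B' w = e_4]. *)
Lemma rescaled_boundary b rho c : rescaledB b rho c \in unitmx ->
  rescaled_sol b rho c b (inord 2) 0 - 1 =
  - ((4 * pi * rho ^+ 2)%:C * rescaled_sol b rho c b (inord 0) 0).
Proof.
move=> uB.
have : (rescaledB b rho c *m rescaled_init b rho c) (inord 3) 0 = 1.
  by rewrite /rescaled_init mulKVmx // mxE !eqxx.
rewrite /rescaledB mulmxDl -mulmxA -/(rescaled_sol b rho c b) mxE.
move: (rescaled_sol _ _ _ _) (rescaled_init _ _ _) => z w.
rewrite !mxE !sum4E !mxE !inordK //= !mul0r !addr0 !add0r mul1r => <-.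
ring.
Qed.

End RescaledEstimates.

(** * Euclidean norm and the O-notation *)

Section BigO.
Context {R : realType} {d : nat}.
Implicit Types xi : 'rV[R]_d.+1.

Lemma enorm_ge_coord xi j : `|xi 0 j| <= enorm xi.
Proof.
rewrite -sqrtr_sqr /enorm ler_wsqrtr // (bigD1 j) //= lerDl.
by apply: sumr_ge0 => i _; exact: sqr_ge0.
Qed.

Lemma enorm_gt0 xi : xi != 0 -> 0 < enorm xi.
Proof.
move=> xi0; rewrite lt_def sqrtr_ge0 andbT; apply: contra xi0 => /eqP e0.
apply/eqP/rowP => j; rewrite mxE; apply/eqP.
by rewrite -normr_le0 -e0 enorm_ge_coord.
Qed.

(** Compares with the sup norm, which defines the topology, so that Euclidean balls are
    neighbourhoods of 0. *)
Lemma enorm_le_norm xi : enorm xi <= d.+1%:R * `|xi|.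
Proof.
rewrite -(@ger0_norm _ (d.+1%:R * `|xi|)) ?mulr_ge0 // -sqrtr_sqr ler_wsqrtr //.
apply: (@le_trans _ _ (\sum_(j < d.+1) `|xi| ^+ 2)).
  apply: ler_sum => j _; rewrite -(real_normK (num_real (xi 0 j))) lerXn2r ?nnegrE //.
  rewrite [leRHS](mx_normrE xi).
  by apply/bigmax_geP; right; exists (0, j).
rewrite sumr_const card_ord exprMn -[leLHS]mulr_natl ler_wpM2r ?sqr_ge0 //.
by rewrite -natrX ler_nat expnS leq_pmulr // expn_gt0.
Qed.

Lemma bigO_at0_of_bound (T : Type) (nrm : T -> R) (b : R) (k : nat)
    (F : 'rV[R]_d.+1 -> R -> T) (K delta : R) :
  0 < delta ->
  (forall xi xn, xi != 0 -> enorm xi <= delta -> 0 <= xn <= b ->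
    nrm (F xi xn) <= K * enorm xi ^+ k) ->
  bigO_at0 nrm b k F.
Proof.
move=> d0 bound; rewrite /bigO_at0 limf_esupE.
pose V := [set xi : 'rV[R]_d.+1 | xi != 0 /\ enorm xi <= delta].
(* The limsup is an infimum over punctured neighbourhoods, so its value on the single neighbourhood
   [V] bounds it. *)
apply: (@le_lt_trans _ _ K%:E); last exact: ltry.
apply: (@le_trans _ _ (ereal_sup [set ereal_sup [set (nrm (F xi xn) / enorm xi ^+ k)%:E
    | xn in [set xn : R | 0 <= xn <= b]] | xi in V])).
  apply: ereal_inf_lbound; exists V => //.
  have : \forall xi \near (0 : 'rV[R]_d.+1), enorm xi <= delta.
    have e0 : 0 < delta / d.+1%:R by rewrite divr_gt0.
    apply: filterS (nbhs0_lt e0) => xi /ltW h.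
    by apply: le_trans (enorm_le_norm xi) _; rewrite mulrC -ler_pdivlMr.
  by apply: filterS => xi h xi0; split.
apply: ge_ereal_sup => _ [xi [xi0 xid] <-]; apply: ge_ereal_sup => _ [xn xnb <-].
by rewrite lee_fin ler_pdivrMr ?exprn_gt0 ?enorm_gt0 // bound.
Qed.

End BigO.

Ltac nonneg := solve [repeat first
  [ done | exact: expR_ge0 | exact: sumnorm_ge0 | exact: sqr_ge0
  | apply: addr_ge0 | apply: mulr_ge0 ]].

(** * Estimates for the rescaled solution, uniform in x *)

Section UniformEstimate.
Context {R : realType}.
Implicit Types (rho x b C : R) (c : R[i]).

Lemma scaleS_mulE rho (z : 'cV[R[i]]_4) :
  [/\ (scaleS rho *m z) (inord 0) 0 = rho%:C * z (inord 0) 0,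
      (scaleS rho *m z) (inord 1) 0 = rho%:C ^+ 2 * z (inord 1) 0 &
      (scaleS rho *m z) (inord 2) 0 = z (inord 2) 0].
Proof. by split; rewrite mxE sum4E !mx4E //= !mul0r ?mul1r ?add0r ?addr0. Qed.

Lemma limit_solE b x :
  limit_sol b x (inord 0) 0 = (pi * (2 * x * b - x ^+ 2))%:C /\
  limit_sol b x (inord 1) 0 = (2 * pi ^+ 2 * x ^+ 2 * (x / 3 - b))%:C.
Proof. by rewrite /limit_sol mulmxA mx4M !mx4_e4 //=; split; field. Qed.

Lemma rescaled_sol_estimate b C : 0 <= b -> 0 <= C ->
  exists K delta, 0 < delta /\ forall rho c, 0 <= rho <= delta ->
    cabs c <= C * rho ->
    rescaledB b rho c \in unitmx /\
    forall x, 0 <= x <= b ->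
      sumnorm (rescaled_sol b rho c x - limit_sol b x) <= K * rho /\
      cabs (rescaled_sol b rho c x (inord 2) 0 - 1) <= K * rho ^+ 2.
Proof.
move=> b0 C0; have pi0 := pi_ge0 R.
(* [KA], [K2] and [K5] are the rates in rho for A', exp(x A') and G B'; [M] and [K3] bound x A' and
   exp(x A') for x in [0, b]. *)
pose KA := 2 * C + 2 * pi.
have KA0 : 0 <= KA by nonneg.
pose A0 := rescaledA (0 : R) 0; pose M := b * (sumnorm A0 + KA).
have M0 : 0 <= M by nonneg.
pose K2 := expR M * (b * KA).
have K20 : 0 <= K2 by nonneg.
pose K3 := sumnorm (1%:M : 'M[R[i]]_4) + expR M * M.
have K30 : 0 <= K3 by nonneg.
pose G := limitBinv b; pose N0 := rescaledN (0 : R).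
pose K5 := sumnorm G * (sumnorm N0 * K2 + 6 * pi * K3).
have K50 : 0 <= K5 by nonneg.
pose e4 : 'cV[R[i]]_4 := delta_mx (inord 3) 0.
pose W0 := 2 * sumnorm (G *m e4).
have W00 : 0 <= W0 by nonneg.
(* [W] bounds the initial vector, which lies within K5 W0 rho of G e_4, for rho <= 1. *)
pose W := sumnorm (G *m e4) + K5 * W0.
have W_ge0 : 0 <= W by nonneg.
(* [Ka] is the rate for the whole solution, [Kb] the one for the variation of its third component,
   [Kc] the one for that component at x = b. *)
pose Ka := K2 * W + K3 * (K5 * W0).
pose Kb := expR M * (b * (C + 2 * pi)) * W.
pose Kc := 4 * pi * (K3 * W).
have Ka0 : 0 <= Ka by nonneg.
have Kb0 : 0 <= Kb by nonneg.
have Kc0 : 0 <= Kc by nonneg.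
(* rho <= 1 absorbs higher powers of rho; the second bound gives K5 rho <= 1/2, as the perturbation
   lemmas require. *)
exists (Ka + (2 * Kb + Kc)), (Num.min 1 (2^-1 / (K5 + 1))).
have K51 : 0 < K5 + 1 by rewrite ltr_wpDl.
split; first by rewrite lt_min ltr01 /= divr_gt0.
move=> rho c /andP[r0]; rewrite le_min ler_pdivlMr // => /andP[r1 rK] cC.
have r01 : 0 <= rho <= 1 by rewrite r0.
have hA := rescaledA_near r01 cC; rewrite -/KA -/A0 in hA.
set A := rescaledA rho c in hA.
have AM : sumnorm A <= sumnorm A0 + KA.
  have := sumnormD (A - A0) A0; rewrite subrK.
  have : KA * rho <= KA by exact: ler_piMr.
  lra.
have xM x (B : 'M[R[i]]_4) : 0 <= x <= b -> sumnorm B <= sumnorm A0 + KA ->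
    sumnorm (x%:C *: B) <= M.
  move=> /andP[x0 xb] BM; rewrite sumnormZ cabs_real ger0_norm //.
  by apply: ler_pM; rewrite ?sumnorm_ge0.
have A0M : sumnorm A0 <= sumnorm A0 + KA by rewrite lerDl.
have hE x : 0 <= x <= b ->
    sumnorm (mexp (x%:C *: A) - mexp (x%:C *: A0)) <= K2 * rho.
  move=> xb; apply: le_trans (sumnorm_mexpB (xM _ _ xb AM) (xM _ _ xb A0M)) _.
  rewrite /K2 -!mulrA ler_wpM2l ?expR_ge0 // -scalerBr sumnormZ cabs_real.
  case/andP: xb => x0 xb; rewrite ger0_norm //.
  by apply: ler_pM; rewrite ?sumnorm_ge0.
have bb : 0 <= b <= b by rewrite b0 lexx.
have E3 x : 0 <= x <= b -> sumnorm (mexp (x%:C *: A)) <= K3.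
  by move=> xb; apply: sumnorm_mexp_le; exact: xM.
have E03 x : 0 <= x <= b -> sumnorm (mexp (x%:C *: A0)) <= K3.
  by move=> xb; apply: sumnorm_mexp_le; exact: xM.
have hB : sumnorm (G *m (rescaledB b rho c - rescaledB b 0 0)) <= K5 * rho.
  apply: le_trans (sumnormM _ _) _; rewrite /K5 -mulrA ler_wpM2l ?sumnorm_ge0 //.
  rewrite /rescaledB opprD addrACA subrr add0r.
  apply: le_trans (sumnorm_mulmxB _ _ _ _) _; rewrite addrC mulrDl; apply: lerD.
    by rewrite -mulrA ler_wpM2l ?sumnorm_ge0 ?hE.
  by rewrite mulrAC; apply: ler_pM; rewrite ?sumnorm_ge0 ?rescaledN_near ?E3.
have small : sumnorm (G *m (rescaledB b rho c - rescaledB b 0 0)) <= 2^-1.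
  apply: le_trans hB _; apply: le_trans rK.
  by rewrite mulrC ler_wpM2l // lerDl.
have GB := limitBinvP b.
have uB := perturbed_unitmx GB small.
split=> // x xb.
have hw : sumnorm (rescaled_init b rho c - G *m e4) <= K5 * W0 * rho.
  apply: le_trans (perturbed_solution e4 GB small) _.
  by rewrite -/W0 mulrAC ler_wpM2r.
have wW : sumnorm (rescaled_init b rho c) <= W.
  have := sumnormD (rescaled_init b rho c - G *m e4) (G *m e4).
  rewrite subrK => h; apply: le_trans h _; rewrite addrC lerD2l.
  apply: le_trans hw _; apply: ler_piMr => //; nonneg.
rewrite /rescaled_sol -/A.
have solW t : 0 <= t <= b ->
    sumnorm (mexp (t%:C *: A) *m rescaled_init b rho c) <= K3 * W.
  move=> tb; apply: le_trans (sumnormM _ _) _.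
  by apply: ler_pM; rewrite ?sumnorm_ge0 ?E3.
(* With [U] the unit row picking the third component, U A' is O(rho^2), hence so is U exp(t A') -
   U. *)
have var t : 0 <= t <= b ->
    cabs ((mexp (t%:C *: A) *m rescaled_init b rho c) (inord 2) 0 -
          rescaled_init b rho c (inord 2) 0) <= Kb * rho ^+ 2.
  move=> tb; pose U : 'rV[R[i]]_4 := delta_mx 0 (inord 2).
  have rowU (z : 'cV[R[i]]_4) : z (inord 2) 0 = (U *m z) 0 0.
    by rewrite /U -rowE mxE.
  rewrite !rowU mulmxA.
  set w := rescaled_init _ _ _ in wW *; set E := mexp _.
  have -> : (U *m E *m w) 0 0 - (U *m w) 0 0 = ((U *m E - U) *m w) 0 0.
    by rewrite mulmxBl [RHS]mxE; congr (_ + _); rewrite [RHS]mxE.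
  apply: le_trans (cabs_le_sumnorm _ _ _) _; apply: le_trans (sumnormM _ _) _.
  rewrite mulrAC; apply: ler_pM; rewrite ?sumnorm_ge0 //.
  apply: le_trans (sumnorm_mul_mexpB _ _) _; rewrite -mulrA.
  apply: ler_pM; rewrite ?expR_ge0 ?sumnorm_ge0 ?ler_expR ?xM //.
  rewrite -scalemxAr sumnormZ cabs_real.
  case/andP: tb => t0 tb; rewrite ger0_norm // -mulrA.
  apply: ler_pM; rewrite ?sumnorm_ge0 //.
  exact: sumnorm_rescaledA_row3.
split.
  rewrite mulrDl; apply: (@le_trans _ _ (Ka * rho)); last first.
    by rewrite lerDl; nonneg.
  rewrite /limit_sol -mexp_rescaledA0 -/G -/e4 -/A0.
  apply: le_trans (sumnorm_mulmxB _ _ _ _) _; rewrite /Ka mulrDl; apply: lerD.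
    by rewrite mulrAC; apply: ler_pM; rewrite ?sumnorm_ge0 ?hE.
  by rewrite -mulrA; apply: ler_pM; rewrite ?sumnorm_ge0 ?E03.
have bdry := rescaled_boundary uB.
have hb : cabs ((mexp (b%:C *: A) *m rescaled_init b rho c) (inord 2) 0 - 1)
    <= Kc * rho ^+ 2.
  rewrite [X in cabs X]bdry cabsN cabsM cabs_real ger0_norm; last by nonneg.
  rewrite /Kc [leRHS]mulrAC; apply: ler_wpM2l; first by nonneg.
  by apply: le_trans (cabs_le_sumnorm _ _ _) _; exact: solW.
(* From x back to 0, from 0 to b, then from the value at b to 1. *)
apply: le_trans (cabsB_chain (var x xb) (var b bb) hb) _.
have : 0 <= Ka * rho ^+ 2 by nonneg.
lra.
Qed.

End UniformEstimate.

(** * Undoing the scaling: the four expansions *)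

Theorem theorem4p7 (R : realType) (d : nat) (b : R) (b_gt0 : 0 < b) (gamma : R) :
  [/\ bigO_at0 (@cenorm R d.+1) b 2 (fun (xi : 'rV[R]_d.+1) (xn : R) =>
        Vtangent b xi xn gamma
        - (- 'i%C * pi%:C * (2 * xn * b - xn ^+ 2)%:C)
            *: map_mx (fun t : R => t%:C) xi),
      bigO_at0 (@cabs R) b 3 (fun (xi : 'rV[R]_d.+1) (xn : R) =>
        Vnormal b xi xn gamma
        - (2 * pi ^+ 2 * enorm xi ^+ 2 * xn ^+ 2 * (xn / 3 - b))%:C),
      bigO_at0 (@cabs R) b 3 (fun (xi : 'rV[R]_d.+1) (_ : R) =>
        msymb b xi gamma
        - (- (4 * pi ^+ 2 * enorm xi ^+ 2 * b ^+ 3 / 3))%:C) &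
      bigO_at0 (@cabs R) b 2 (fun (xi : 'rV[R]_d.+1) (xn : R) =>
        Qpressure b xi xn gamma - 1)].
Proof.
have pi0 := pi_ge0 R; have b0 := ltW b_gt0.
(* For |xi| <= 1 the modulus of [coefA xi gamma] is at most C |xi|, since |xi_1| <= |xi|. *)
pose C : R := 4 * pi ^+ 2 + 2 * pi * `|gamma|.
have C0 : 0 <= C by nonneg.
have [K [delta [delta0 est]]] := rescaled_sol_estimate b0 C0.
have eps0 : 0 < Num.min 1 delta by rewrite lt_min ltr01.
have key (xi : 'rV[R]_d.+1) : xi != 0 -> enorm xi <= Num.min 1 delta ->
    exists z : R -> 'cV[R[i]]_4, forall xn, 0 <= xn <= b ->
      [/\ soly b xi xn gamma = scaleS (enorm xi) *m z xn,
          sumnorm (z xn - limit_sol b xn) <= K * enorm xi &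
          cabs (z xn (inord 2) 0 - 1) <= K * enorm xi ^+ 2].
  move=> /enorm_gt0 xi0; rewrite le_min => /andP[xi1 xid].
  have cC : cabs (coefA xi gamma) <= C * enorm xi.
    apply: le_trans (cabsD _ _) _; rewrite cabsN !cabsM cabs_i !cabs_real mulr1.
    rewrite /C [leRHS]mulrDl; apply: lerD.
      rewrite ger0_norm; last by nonneg.
      apply: ler_wpM2l; first by nonneg.
      by rewrite expr2; apply: ler_piMr => //; exact: ltW.
    rewrite ger0_norm; last by nonneg.
    rewrite normrM -[leRHS]mulrA; apply: ler_wpM2l; first by nonneg.
    by rewrite mulrC; apply: ler_wpM2l => //; exact: enorm_ge_coord.
  have [|uB hz] := est (enorm xi) _ _ cC; first by rewrite ltW.
  exists (rescaled_sol b (enorm xi) (coefA xi gamma)) => xn /hz[h1 h2]; split=> //.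
  by apply: soly_scale; rewrite ?gt_eqF.
have normal (xi : 'rV[R]_d.+1) xn : xi != 0 -> enorm xi <= Num.min 1 delta ->
    0 <= xn <= b -> cabs (Vnormal b xi xn gamma -
      (2 * pi ^+ 2 * enorm xi ^+ 2 * xn ^+ 2 * (xn / 3 - b))%:C)
    <= K * enorm xi ^+ 3.
  move=> xi0 xid xnb; have [z /(_ xn xnb)[yE hz _]] := key xi xi0 xid.
  have [_ l1] := limit_solE b xn; have [_ s1 _] := scaleS_mulE (enorm xi) (z xn).
  rewrite /Vnormal yE s1.
  have -> : (2 * pi ^+ 2 * enorm xi ^+ 2 * xn ^+ 2 * (xn / 3 - b))%:C =
      (enorm xi)%:C ^+ 2 * limit_sol b xn (inord 1) 0.
    by rewrite l1 -rmorphXn -rmorphM; congr (_%:C); ring.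
  rewrite -mulrBr cabsM -rmorphXn cabs_real ger0_norm; last by nonneg.
  rewrite exprS mulrA [leRHS]mulrC ler_wpM2l //; first by nonneg.
  exact: le_trans (cabs_entryB_le _ _ _ _) hz.
split.
- apply: (bigO_at0_of_bound (K := K) eps0) => xi xn xi0 xid xnb.
  have [z /(_ xn xnb)[yE hz _]] := key xi xi0 xid.
  have [l0 _] := limit_solE b xn; have [s0 _ _] := scaleS_mulE (enorm xi) (z xn).
  have e0 := enorm_gt0 xi0.
  set D := z xn (inord 0) 0 - limit_sol b xn (inord 0) 0.
  have DK : cabs D <= K * enorm xi.
    exact: le_trans (cabs_entryB_le _ _ _ _) hz.
  (* The weight rho of the first component cancels the division by |xi| in V', so entry j of the
     error is -i D xi_j and its Hermitian norm is |D| |xi|. *)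
  have coord j : cabs ((Vtangent b xi xn gamma
      - (- 'i%C * pi%:C * (2 * xn * b - xn ^+ 2)%:C)
            *: map_mx (fun t : R => t%:C) xi) 0 j) = cabs D * `|xi 0 j|.
    rewrite /Vtangent (negbTE xi0) yE s0 !mxE.
    rewrite [X in cabs X](_ : _ = - 'i%C * (D * (xi 0 j)%:C)).
      by rewrite cabsM cabsN cabs_i mul1r cabsM cabs_real.
    have -> : (xi 0 j)%:C = (enorm xi)%:C * (xi 0 j / enorm xi)%:C.
      by rewrite -rmorphM mulrC divfK ?gt_eqF.
    rewrite /D l0; ring.
  rewrite /cenorm (eq_bigr (fun j => cabs D ^+ 2 * xi 0 j ^+ 2)); last first.
    by move=> j _; rewrite coord exprMn real_normK ?num_real.
  rewrite -mulr_sumr sqrtrM ?sqr_ge0 // sqrtr_sqr ger0_norm ?cabs_ge0 //.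
  by rewrite expr2 mulrA ler_wpM2r // ltW.
- by apply: (bigO_at0_of_bound (K := K) eps0) => xi xn; exact: normal.
- apply: (bigO_at0_of_bound (K := K) eps0) => xi xn xi0 xid _.
  (* At x_n = b the factor b/3 - b equals -2b/3. *)
  have := normal xi b xi0 xid; rewrite b0 lexx => /(_ isT).
  by rewrite /msymb (_ : 2 * _ * _ * _ * _ = - (4 * pi ^+ 2 * enorm xi ^+ 2 * b ^+ 3
    / 3)) //; field.
- apply: (bigO_at0_of_bound (K := K) eps0) => xi xn xi0 xid xnb.
  have [z /(_ xn xnb)[yE _ hz]] := key xi xi0 xid.
  have [_ _ s2] := scaleS_mulE (enorm xi) (z xn).
  (* The third weight of S is 1, so the quadratic estimate carries over unchanged. *)
  by rewrite /Qpressure yE s2.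
Qed.
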